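(* Let $1\le a<b\le\infty$ and let $\vec s=(s(1),\dots,s(k))$ be a vector with $s(j)>0$ for all $j$. (A) Let $\psi,\zeta,\nu\in E\Psi(a,b)$ with $\zeta(p)=\psi(p)\,\nu(p)$ for $p\in(a,b)$. Then $$\|\sigma_{\vec s}\|(G(\psi)\to G(\zeta))\le \phi\left(G(\nu),\vec s^{\,\vec d+\vec\theta}\right).$$ (B) Let $\psi\in\Psi(a,b)$ and $\zeta,\nu\in E\Psi(a,b)$ with $\zeta(p)=\psi(p)\,\nu(p)$ for $p\in(a,b)$. Then $$\|\sigma_{\vec s}\|(G(\psi)\to G(\zeta))= \phi\left(G(\nu),\vec s^{\,\vec d+\vec\theta}\right).$$
   Context: Setting. $X=\mathbb{R}_+^{d(1)}\times\cdots\times\mathbb{R}_+^{d(k)}$, where $k\ge1$, $d(j)\ge 1$ are integers, $\mathbb{R}_+=[0,\infty)$; points are written $x=(x(d(1)),\dots,x(d(k)))$ with $x(d(j))\in\mathbb{R}_+^{d(j)}$. $X$ carries the Borel $\sigma$-algebra and the measure $\mu(V)=\int_V W(x)\,dx$, where $W(x)=\prod_{r=1}^k W_r(x(d(r)))$ and each $W_r$ is nontrivial (not identically zero), nonnegative, continuous away from the origin, and homogeneous of order $\theta(r)\in\mathbb{R}$: $W_r(\lambda y)=\lambda^{\theta(r)}W_r(y)$ for all $\lambda>0$. Put $\vec d=(d(1),\dots,d(k))$, $\vec\theta=(\theta(1),\dots,\theta(k))$, and $\vec s^{\,\vec d+\vec\theta}=\prod_{r=1}^k s(r)^{d(r)+\theta(r)}$.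 Classes of functions. For $1\le a<b\le\infty$, $E\Psi(a,b)$ is the set of continuous functions $\psi:(a,b)\to[1,\infty)$ such that the limits $\psi(a+0)$ and $\psi(b-0)$ exist (possibly infinite) and $\psi(b-0)=\infty$. $\Psi(a,b)$ is the subset of those $\psi\in E\Psi(a,b)$ having a representation: there is a measurable $f:X\to\mathbb{R}$ with $f\in\bigcap_{p\in(a,b)}L_p(X,\mu)$ and $\psi(p)=|f|_p$ for all $p\in(a,b)$, where $|f|_p=\left(\int_X|f|^p\,d\mu\right)^{1/p}$. Bilateral Grand Lebesgue space. For $\psi\in E\Psi(a,b)$, $G(\psi)=G(\psi;a,b)$ is the space of measurable $h:X\to\mathbb{R}$ (modulo a.e. equality) with $\|h\|G(\psi)=\sup_{p\in(a,b)}|h|_p/\psi(p)<\infty$. Fundamental function. $\phi(G(\nu),\delta)=\|I(A)\|G(\nu)$ for any measurable $A$ with $\mu(A)=\delta$ ($I(A)$ is the indicator function of $A$), i.e. $\phi(G(\nu),\delta)=\sup_{p\in(a,b)}\delta^{1/p}/\nu(p)$. Dilation operator. $\sigma_{\vec s}f(x)=f\left(\frac{x(d(1))}{s(1)},\dots,\frac{x(d(k))}{s(k)}\right)$. $\|\sigma_{\vec s}\|(V_1\to V_2)$ denotes its operator norm from $V_1$ to $V_2$. *)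

(* Defs.v *)
From HB Require Import structures.
From mathcomp Require Import all_boot all_order all_algebra.
From mathcomp Require Import all_classical all_reals all_analysis.

Set Implicit Arguments.
Unset Strict Implicit.
Unset Printing Implicit Defensive.
Import Order.TTheory GRing.Theory Num.Theory.
Import numFieldNormedType.Exports.
Local Open Scope classical_set_scope.
Local Open Scope ring_scope.

Section borel_rV.
Context {R : realType} (n : nat).

HB.instance Definition _ :=
  @isMeasurable.Build (sigma_display (@open 'rV[R]_n)) 'rV[R]_n
    <<s @open 'rV[R]_n >> (@sigma_algebra0 _ setT _) (@sigma_algebraC _ _)
    (@sigma_algebra_bigcup _ setT _).

Lemma measurable_fun_coord (i : 'I_n) :
  measurable_fun setT (fun x : 'rV[R]_n => x ord0 i : R).
Proof.
apply: (measurability _ (measurable_realfun.RGenOInfty.measurableE R)).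
move=> _ [_ [r ->] <-]; rewrite setTI; apply: sub_sigma_algebra.
apply: open_comp; last exact: rray_open.
by move=> x _; exact: coord_continuous.
Qed.

Lemma measurable_fun_rV d (T : measurableType d) (f : T -> 'rV[R]_n) :
  (forall i, measurable_fun setT (fun t => f t ord0 i : R)) ->
  measurable_fun setT f.
Proof.
move=> mf; apply: (measurability (@open 'rV[R]_n)) => // _ [U oU <-].
pose box (c : 'rV[rat]_n * nat) :=
  [set x : 'rV[R]_n | forall i, ball (ratr (c.1 ord0 i) : R) c.2.+1%:R^-1 (x ord0 i)].
pose F c := if `[< box c `<=` U >] then box c else set0.
have -> : U = \bigcup_c F c.
  apply/seteqP; split => [x Ux|x [c _]]; last first.
    by rewrite /F; case: asboolP => // + bx; apply.
  have /nbhs_ballP[e /= e0 xeU] : nbhs x U by exact: open_nbhs_nbhs.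
  have [m me] : exists m : nat, m.+1%:R^-1 < e / 2 :> R.
    have e20 : 0 < (e / 2)^-1 by rewrite invr_gt0 divr_gt0.
    exists (Num.Def.trunc (e / 2)^-1).
    rewrite -[ltRHS]invrK ltf_pV2 ?posrE// ?ltr0n//; exact: truncnS_gt.
  have /choice[q qP] (i : 'I_n) : exists q : rat,
      ball (ratr q : R) m.+1%:R^-1 (x ord0 i).
    have xm : x ord0 i < x ord0 i + m.+1%:R^-1 by rewrite ltrDl invr_gt0.
    have [q] := rat_in_itvoo xm.
    rewrite in_itv/= => /andP[xq qx]; exists q; apply: ball_sym.
    by rewrite /ball/= distrC ger0_norm ?subr_ge0 1?ltW// ltrBlDl.
  exists (\row_i q i, m) => //; rewrite /F ifT.
    by move=> i /=; rewrite mxE; exact: qP.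
  apply/asboolP => y /= yb; apply: xeU; split => // i j.
  rewrite (ord1 i); have := yb j; rewrite mxE => qy.
  rewrite (splitr e).
  apply: (@ball_triangle _ _ (ratr (q j) : R)).
    apply: ball_sym; apply: le_ball (qP j); exact: ltW.
  by apply: le_ball qy; exact: ltW.
rewrite setTI preimage_bigcup.
apply: countable_bigcupT_measurable; first exact: countableP.
move=> c; rewrite /F; case: asboolP => _; last by rewrite preimage_set0.
rewrite (_ : _ @^-1` _ = \bigcap_(i in [set: 'I_n])
  (fun t => f t ord0 i) @^-1` ball (ratr (c.1 ord0 i) : R) c.2.+1%:R^-1).
  apply: fin_bigcap_measurable => // i _; rewrite -[X in measurable X]setTI.
  by apply: mf => //; rewrite ball_itv; exact: measurable_itv.
by apply/seteqP; split => [t ft i _|t ft i]; apply: ft.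
Qed.

End borel_rV.

Section lebesgue_rV.
Context {R : realType}.

Definition rV_cons n (p : measurableTypeR R * 'rV[R]_n) : 'rV[R]_(1 + n) :=
  row_mx (const_mx p.1) p.2.

Lemma measurable_rV_cons n : measurable_fun setT (@rV_cons n).
Proof.
apply: measurable_fun_rV => i; case: (split_ordP i) => j ->.
  by under eq_fun do rewrite row_mxEl mxE; exact: measurable_fst.
under eq_fun do rewrite row_mxEr.
exact: (measurableT_comp (measurable_fun_coord j) measurable_snd).
Qed.

Section step.
Local Open Scope ereal_scope.
Context n (m : {sigma_finite_measure set 'rV[R]_n -> \bar R}).

Definition lebesgue_step : set 'rV[R]_(1 + n) -> \bar R :=
  pushforward (@lebesgue_measure R \x m) (@rV_cons n).

Let mpre (A : set 'rV[R]_(1 + n)) : measurable A -> measurable (@rV_cons n @^-1` A).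
Proof. by move=> mA; rewrite -[X in measurable X]setTI; exact: measurable_rV_cons. Qed.

Let step0 : lebesgue_step set0 = 0.
Proof. by rewrite /lebesgue_step /pushforward preimage_set0 measure0. Qed.

Let step_ge0 A : 0 <= lebesgue_step A.
Proof. by rewrite /lebesgue_step /pushforward; exact: measure_ge0. Qed.

Let step_sigma_additive : semi_sigma_additive lebesgue_step.
Proof.
move=> F mF tF mUF; rewrite /lebesgue_step /pushforward preimage_bigcup.
apply: measure_semi_sigma_additive.
- by move=> i; exact: mpre.
- apply/trivIsetP => /= i j _ _ ij; rewrite -preimage_setI.
  by move/trivIsetP : tF => /(_ _ _ _ _ ij) ->//; rewrite preimage_set0.
- by rewrite -preimage_bigcup; exact: mpre.
Qed.

HB.instance Definition _ := isMeasure.Build _ _ _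
  lebesgue_step step0 step_ge0 step_sigma_additive.

Let step_sigma_finite : sigma_finite setT lebesgue_step.
Proof.
have /sigma_finiteP[F [TF ndF Foo]] := sigma_finiteT (@lebesgue_measure R).
have /sigma_finiteP[G [TG ndG Goo]] := sigma_finiteT m.
have FGm k : measurable (F k `*` G k).
  by apply: measurableX; [exact: (Foo k).1|exact: (Goo k).1].
pose u (x : 'rV[R]_(1 + n)) : measurableTypeR R * 'rV[R]_n :=
  (x ord0 (lshift n ord0), rsubmx x).
have mu : measurable_fun setT u.
  apply: measurable_fun_pair; first exact: measurable_fun_coord.
  apply: measurable_fun_rV => i; under eq_fun do rewrite mxE.
  exact: measurable_fun_coord.
have uK p : u (rV_cons p) = p.
  by case: p => x y; rewrite /u /rV_cons row_mxEl mxE row_mxKr.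
exists (fun k => u @^-1` (F k `*` G k)).
  rewrite -preimage_bigcup (_ : \bigcup_k _ = setT) ?preimage_setT//.
  rewrite -setXTT TF TG predeqE => -[x y]; split => [[k _ []/= ? ?]|].
    by split; exists k.
  move=> [/= [k _ Fkx] [l _ Gly]]; exists (maxn k l) => //; split.
  - by move: x Fkx; exact/subsetPset/ndF/leq_maxl.
  - by move: y Gly; exact/subsetPset/ndG/leq_maxr.
move=> k; split; first by rewrite -[X in measurable X]setTI; exact: mu.
rewrite /lebesgue_step /pushforward (_ : _ @^-1` _ = F k `*` G k); last first.
  by rewrite -comp_preimage (_ : u \o _ = id)//; exact/funext/uK.
have [? ?] := Foo k; have [? ?] := Goo k.
by rewrite product_measure1E// lte_mul_pinfty// ge0_fin_numE.
Qed.

HB.instance Definition _ := Measure_isSigmaFinite.Build _ _ _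
  lebesgue_step step_sigma_finite.

End step.

Fixpoint lebesgue_rV n : {sigma_finite_measure set 'rV[R]_n -> \bar R} :=
  if n is n'.+1 then lebesgue_step (lebesgue_rV n')
  else \d_(0 : 'rV[R]_0).

End lebesgue_rV.

Section bilateral_grand_lebesgue.
Context {R : realType}.

Definition orthant n : set 'rV[R]_n := [set y | forall i, 0 <= y ord0 i].

Definition homogeneous_weight n (theta : R) (w : 'rV[R]_n -> R) : Prop :=
  [/\ exists2 y, orthant y & w y != 0,
      forall y, orthant y -> 0 <= w y,
      {within @orthant n `\ 0, continuous w} &
      forall lam y, 0 < lam -> orthant y -> w (lam *: y) = lam `^ theta * w y].

Section product_space.
Context (k : nat) (d : 'I_k -> nat).

(* The r-th block x(d(r)) of x is [submxrow x r]. *)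
Let V := 'rV[R]_(\sum_(r < k) d r).

Definition product_orthant : set V :=
  [set x | forall r, orthant (submxrow x r)].

Definition dilation (s : 'I_k -> R) (f : V -> R) (x : V) : R :=
  f (\mxrow_(r < k) ((s r)^-1 *: submxrow x r)).

Definition product_weight (W : forall r, 'rV[R]_(d r) -> R) (x : V) : R :=
  \prod_(r < k) W r (submxrow x r).

Section spaces.
Context (W : forall r, 'rV[R]_(d r) -> R).
Local Open Scope ereal_scope.

(* Functions on X are represented by functions on the whole of V whose values
   outside X = [product_orthant] are never used; likewise this is a measure
   on V carried by X. *)
Definition weighted_measure (A : set V) : \bar R :=
  \int[lebesgue_rV _]_(x in A `&` product_orthant) (product_weight W x)%:E.

Definition Lp_norm (p : R) (f : V -> R) : \bar R :=
  (\int[weighted_measure]_(x in product_orthant) (`|f x| `^ p)%:E) `^ p^-1.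

Definition Lp (p : R) : set (V -> R) :=
  [set f | measurable_fun product_orthant f /\ Lp_norm p f < +oo].

Section exponent_range.
Context (a : R) (b : \bar R).

Definition exponents : set R := [set p | (a < p)%R /\ p%:E < b].

(* Only the values of psi on the open interval (a, b) matter. *)
Definition EPsi : set (R -> R) :=
  [set psi : R -> R | [/\ forall p, exponents p -> (1 <= psi p)%R,
    forall p, exponents p -> {for p, continuous psi},
    exists l : \bar R, (psi p)%:E @[p --> a^'+] --> l &
    match b with
    | b'%:E => (psi p)%:E @[p --> b'^'-] --> +oo
    | +oo => (psi p)%:E @[p --> +oo%R] --> +oo
    | -oo => False
    end]].

Definition Psi : set (R -> R) :=
  EPsi `&` [set psi : R -> R | exists2 f : V -> R,
    (\bigcap_(p in exponents) Lp p) f &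
    forall p, exponents p -> (psi p)%:E = Lp_norm p f].

Definition G_norm (psi : R -> R) (h : V -> R) : \bar R :=
  ereal_sup [set Lp_norm p h * (psi p)^-1%:E | p in exponents].

Definition G_space (psi : R -> R) : set (V -> R) :=
  [set h | measurable_fun product_orthant h /\ G_norm psi h < +oo].

Definition fundamental_function (nu : R -> R) (delta : R) : \bar R :=
  ereal_sup [set (delta `^ p^-1 / nu p)%:E | p in exponents].

(* Infimum of the C >= 0 such that T maps G(psi) into G(zeta) with
   |T h| <= C |h|; it is +oo when there is no such C. *)
Definition G_operator_norm (T : (V -> R) -> (V -> R)) (psi zeta : R -> R) :
    \bar R :=
  ereal_inf [set C%:E | C in [set C : R | (0 <= C)%R /\
    forall h, G_space psi h ->
      G_space zeta (T h) /\ G_norm zeta (T h) <= C%:E * G_norm psi h]].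

End exponent_range.
End spaces.
End product_space.
End bilateral_grand_lebesgue.

(* Main.v *)
From HB Require Import structures.
Require Import Defs.
From mathcomp Require Import all_boot all_order all_algebra.
From mathcomp Require Import all_classical all_reals all_analysis.
From mathcomp Require Import measurable_realfun.

Set Implicit Arguments.
Unset Strict Implicit.
Unset Printing Implicit Defensive.
Import Order.TTheory GRing.Theory Num.Theory.
Import numFieldNormedType.Exports.
Local Open Scope classical_set_scope.
Local Open Scope ring_scope.

(** The dilation acts on every L_p norm by a scalar. Write D for the map
    x |-> (x_r / s_r)_r, which is linear and diagonal and maps X onto itself,
    and delta for the product of the s_r ^ (d_r + theta_r). The substitution
    x = D^-1 y has Jacobian the product of the s_r ^ d_r, and homogeneity of
    the weights contributes the product of the s_r ^ theta_r, so that
    mu (D^-1 A) = delta * mu A ([weighted_measure_block_scale]). Hence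
    |sigma_s h|_p = delta^(1/p) |h|_p for all p ([Lp_norm_dilation]), and,
    since zeta = psi * nu,
      |sigma_s h|_p / zeta(p) = (delta^(1/p) / nu(p)) * (|h|_p / psi(p)).
    Bounding the two factors by their suprema over p gives the upper bound
    ([G_operator_norm_dilation_le]). If psi(p) = |f|_p for some f, then the
    last factor is identically 1 for h = f: f has norm 1 in G(psi) while its
    dilation has norm exactly the fundamental function of G(nu) at delta, so
    the bound is attained ([fundamental_function_le_G_operator_norm]).

    The Jacobian is computed along the inductive construction of Lebesgue
    measure on row vectors, one coordinate at a time, from the scaling of
    Lebesgue measure on the line ([lebesgue_rV_scale]). *)

(** * Scaling of Lebesgue measure *)

Section scaling_measures.
Context d (T : measurableType d) (R : realType).
Local Open Scope ereal_scope.

(** The abstract change of variables behind every substitution below: once a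
    measure is multiplied by a constant under preimage, so are integrals. It
    serves the line, Lebesgue measure on V and the weighted measure. *)
Lemma ge0_integral_comp_scaling (m : {measure set T -> \bar R}) (phi : T -> T)
    (c : R) (D : set T) (f : T -> \bar R) :
    measurable_fun setT phi -> (0 <= c)%R ->
    (forall A, measurable A -> m (phi @^-1` A) = c%:E * m A) ->
    measurable D -> measurable_fun D f -> (forall x, D x -> 0 <= f x) ->
  \int[m]_(x in phi @^-1` D) f (phi x) = c%:E * \int[m]_(x in D) f x.
Proof.
move=> mphi c0 mc mD mf f0.
rewrite -[LHS](ge0_integral_pushforward mphi m mD mf); last first.
  by move=> x /[!inE]; exact: f0.
rewrite -(ge0_integral_mscale m mD (NngNum c0) mf f0).
by apply: (eq_measure_integral (mscale (NngNum c0) m)) => A mA _ /=; exact: mc.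
Qed.

End scaling_measures.

Section lebesgue_scaling.
Context {R : realType}.

Lemma measurable_mull (c : R) :
  measurable_fun setT (fun x : measurableTypeR R => c * x : measurableTypeR R).
Proof. exact: mulrl_measurable. Qed.

(** Lebesgue measure is determined by the half-open intervals, and c times the
    length of ]u / c, v / c] is the length of ]u, v]. *)
Lemma lebesgue_measure_scale (c : R) (A : set (measurableTypeR R)) :
  0 < c -> measurable A ->
  lebesgue_measure ((fun x : measurableTypeR R => c * x) @^-1` A) =
  (c^-1%:E * lebesgue_measure A)%E.
Proof.
move=> c0 mA.
pose mulc (x : measurableTypeR R) : measurableTypeR R := c * x.
have mE : lebesgue_measure A =
    mscale (NngNum (ltW c0)) (pushforward (@lebesgue_measure R) mulc) A.
  move=> mmulc; apply: lebesgue_measure_unique => // _ [[u v]] _ <-.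
  rewrite /= /mscale /pushforward/=.
  have preE : mulc @^-1` [set` `]u, v]] = [set` `](u / c), (v / c)]].
    by apply/seteqP; split=> x /=; rewrite !in_itv/= /mulc;
      rewrite ltr_pdivrMr// ler_pdivlMr// [x * c]mulrC.
  rewrite [X in (_ * lebesgue_measure X)%E]preE !lebesgue_measure_itv/=.
  rewrite !lte_fin ltr_pM2r ?invr_gt0//.
  case: ifPn => _; last by rewrite mule0.
  by rewrite -!EFinB -EFinM mulrBr ![c * _]mulrC !mulfVK// gt_eqF.
rewrite (mE (measurable_mull c)) /mscale/=.
by rewrite muleA -EFinM mulVf ?gt_eqF// mul1e.
Qed.

Definition coord_scale n (c : 'I_n -> R) (x : 'rV[R]_n) : 'rV[R]_n :=
  \row_i (c i * x ord0 i).

Lemma measurable_coord_scale n (c : 'I_n -> R) :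
  measurable_fun setT (coord_scale c).
Proof.
apply: measurable_fun_rV => i; under eq_fun do rewrite mxE.
exact: measurableT_comp (measurable_mull (c i)) (measurable_fun_coord i).
Qed.

Lemma coord_scale_rV_cons n (c : 'I_(1 + n) -> R) x (y : 'rV[R]_n) :
  coord_scale c (rV_cons (x, y)) =
  rV_cons (c (lshift n ord0) * x, coord_scale (c \o @rshift 1 n) y).
Proof.
apply/rowP => i; rewrite mxE; case: (split_ordP i) => j ->.
  by rewrite !row_mxEl !mxE (ord1 j).
by rewrite !row_mxEr !mxE.
Qed.

(** Fubini induction: the section at x of the preimage of A is the preimage,
    under scaling of the other coordinates, of the section at c_1 x of A. The
    induction hypothesis extracts the factors of those coordinates, and a
    one-dimensional substitution extracts the first one. *)
Lemma lebesgue_rV_scale n (c : 'I_n -> R) (A : set 'rV[R]_n) :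
  (forall i, 0 < c i) -> measurable A ->
  lebesgue_rV n (coord_scale c @^-1` A) =
  ((\prod_(i < n) (c i)^-1)%:E * lebesgue_rV n A)%E.
Proof.
elim: n => [|n ih] in c A * => c0 mA.
  rewrite big_ord0 mul1e; congr (lebesgue_rV 0 _).
  by apply/funext => x /=; congr (A _); apply/rowP => -[].
pose c' i := c (rshift 1 i); pose c1 := c (@lshift 1 n ord0).
pose B := @rV_cons R n @^-1` A.
have mB : measurable B.
  by rewrite -[B]setTI; exact: measurable_rV_cons.
have -> : \prod_(i < n.+1) (c i)^-1 = c1^-1 * \prod_(i < n) (c' i)^-1.
  rewrite big_ord_recl; congr ((c _)^-1 * _); first exact: val_inj.
  by apply: eq_bigr => i _; congr ((c _)^-1); exact: val_inj.
set K := \prod_(i < n) _.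
have K0 : 0 <= K by apply: prodr_ge0 => i _; rewrite invr_ge0; exact/ltW/c0.
rewrite /= /lebesgue_step /pushforward /product_measure1 /=.
have secE (x : R) : xsection (@rV_cons R n @^-1` (coord_scale c @^-1` A)) x =
    coord_scale c' @^-1` xsection B (c1 * x).
  apply/seteqP; split => y; rewrite /xsection/= !inE /B/=;
    by rewrite (@coord_scale_rV_cons n c).
pose g (x : measurableTypeR R) := lebesgue_rV n (xsection B x).
have mg : measurable_fun setT g by exact: measurable_fun_xsection.
have g0 x : (0 <= g x)%E by exact: measure_ge0.
rewrite (eq_integral (fun x : measurableTypeR R =>
  K%:E * g (c1 * x : R)%R)%E); last first.
  move=> x _; rewrite secE ih//; first by move=> i; exact: c0.
  exact: measurable_xsection.
have mmul := measurable_mull c1.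
rewrite ge0_integralZl_EFin//; last exact: measurableT_comp mg mmul.
have c1_gt0 : 0 < c1 by exact: c0.
have := @ge0_integral_comp_scaling _ _ _ lebesgue_measure _ c1^-1 setT g mmul.
rewrite preimage_setT => ->//.
- by rewrite muleA -EFinM mulrC.
- by rewrite invr_ge0 ltW.
- by move=> ?; exact: lebesgue_measure_scale.
Qed.
End lebesgue_scaling.

(** * Measurability of the orthant and of the weights *)

Section measurability.
Context {R : realType}.

Lemma measurable_rV_box n (B : 'I_n -> set (measurableTypeR R)) :
  (forall i, measurable (B i)) ->
  measurable [set x : 'rV[R]_n | forall i, B i (x ord0 i)].
Proof.
move=> mB; rewrite (_ : [set _ | _] =
    \bigcap_(i in [set: 'I_n]) (fun x : 'rV[R]_n => x ord0 i) @^-1` B i).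
  apply: fin_bigcap_measurable => // i _; rewrite -[X in measurable X]setTI.
  exact: (measurable_fun_coord i measurableT (mB i)).
by apply/seteqP; split => x xB i; [move=> _|]; exact: xB.
Qed.

Lemma measurable_orthant n : measurable (@orthant R n).
Proof.
rewrite (_ : @orthant R n = [set x | forall i, `[0, +oo[%classic (x ord0 i)]).
  by apply: (@measurable_rV_box n (fun=> `[0, +oo[%classic)) => i;
    exact: measurable_itv.
by apply/seteqP; split => x x0 i; move: (x0 i); rewrite /= in_itv/= andbT.
Qed.

Lemma measurable_rV_set0 n : measurable [set 0 : 'rV[R]_n].
Proof.
rewrite (_ : [set 0] = [set x : 'rV[R]_n | forall i, [set 0] (x ord0 i)]).
  by apply: (@measurable_rV_box n (fun=> [set 0])) => i; exact: measurable_set1.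
apply/seteqP; split => x /=; first by move=> -> i; rewrite mxE.
by move=> x0; apply/rowP => i; rewrite x0 mxE.
Qed.

Lemma within_continuous_measurable_rV n (D : set 'rV[R]_n) (f : 'rV[R]_n -> R) :
  measurable D -> {within D, continuous f} -> measurable_fun D f.
Proof.
move=> mD /continuousP cf.
apply: (measurability _ (measurable_realfun.RGenOpens.measurableE R)).
move=> _ [_ [u [v ->] <-]].
have /open_subspaceP[U oU UD] :=
  cf _ (@interval_open _ (BRight u) (BLeft v) isT isT).
rewrite setIC -UD; apply: measurableI => //; exact: sub_sigma_algebra.
Qed.

(** The weight may be discontinuous at the origin, as when theta < 0, but a
    single point is harmless: the orthant is the union of {0} and of a set on
    which the weight is continuous. *)
Lemma measurable_homogeneous_weight n theta (w : 'rV[R]_n -> R) :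
  homogeneous_weight theta w -> measurable_fun (@orthant R n) w.
Proof.
move=> [_ _ cw _].
have mO0 : measurable (@orthant R n `\ 0).
  by apply: measurableD; [exact: measurable_orthant|exact: measurable_rV_set0].
apply: (@measurable_funS _ _ _ _ ((@orthant R n `\ 0) `|` [set 0])).
- by apply: measurableU => //; exact: measurable_rV_set0.
- by move=> x xO; have [->|/eqP x0] := eqVneq x 0; [right|left].
apply/measurable_funU => //; first exact: measurable_rV_set0.
split; last exact: measurable_fun_set1.
exact: within_continuous_measurable_rV.
Qed.

End measurability.

(** * The dilation and the weighted measure *)

Section dilations.
Context {R : realType} (k : nat) (d : 'I_k -> nat).
Let V := 'rV[R]_(\sum_(r < k) d r).

Lemma product_orthantE : @product_orthant R k d = @orthant R (\sum_(r < k) d r).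
Proof.
apply/seteqP; split => x x0.
  move=> i; rewrite -(tagnat.sig2K i).
  by have := x0 (tagnat.sig1 i) (tagnat.sig2 i); rewrite mxE.
by move=> r j; rewrite mxE; exact: x0.
Qed.

Lemma measurable_product_orthant : measurable (@product_orthant R k d).
Proof. by rewrite product_orthantE; exact: measurable_orthant. Qed.

Lemma measurable_submxrow r :
  measurable_fun setT (fun x : V => submxrow x r).
Proof.
apply: measurable_fun_rV => j.
rewrite (_ : (fun x : V => _) = (fun x : V => x ord0 (tagnat.Rank r j))).
  exact: measurable_fun_coord.
by apply/funext => x; rewrite mxE.
Qed.

(** The point map of [dilation], presented as a diagonal scaling so that
    [lebesgue_rV_scale] applies to it. *)
Definition block_scale (s : 'I_k -> R) : V -> V :=
  coord_scale (fun i => (s (tagnat.sig1 i))^-1).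

Lemma dilationE s (f : V -> R) : dilation s f = f \o block_scale s.
Proof.
apply/funext => x; rewrite /dilation/=; congr f; apply/rowP => i.
by rewrite !mxE tagnat.sig2K.
Qed.

Lemma submxrow_block_scale s (x : V) r :
  submxrow (block_scale s x) r = (s r)^-1 *: submxrow x r.
Proof. by apply/rowP => j; rewrite !mxE tagnat.Rank1K. Qed.

(** The r-th block contributes d r equal factors; this turns the product over
    all the coordinates of V into the exponents d r of the Jacobian. *)
Lemma prod_sig1 (c : 'I_k -> R) :
  \prod_(i < \sum_(r < k) d r) c (tagnat.sig1 i) = \prod_(r < k) c r ^+ d r.
Proof.
rewrite (reindex (@tagnat.rank k d)); last exact/onW_bij/tagnat.rank_bij.
under eq_bigr => p _ do rewrite /tagnat.sig1 tagnat.rankK.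
rewrite -(@sig_big_dep _ _ _ _ _ xpredT (fun _ => xpredT) (fun r _ => c r))/=.
by apply: eq_bigr => r _; rewrite prodr_const card_ord.
Qed.

Section weight.
Context (theta : 'I_k -> R) (W : forall r, 'rV[R]_(d r) -> R).
Hypothesis hW : forall r, homogeneous_weight (theta r) (@W r).

Lemma measurable_product_weight :
  measurable_fun (@product_orthant R k d) (product_weight W).
Proof.
apply: measurable_prod => r _.
apply: (@measurable_comp _ _ _ _ _ _ (@orthant R (d r))).
- exact: measurable_orthant.
- by move=> _ [x x0 <-]; exact: x0.
- exact: measurable_homogeneous_weight.
- by apply: measurable_funTS; exact: measurable_submxrow.
Qed.

Lemma product_weight_ge0 (x : V) :
  product_orthant x -> 0 <= product_weight W x.
Proof.
by move=> x0; apply: prodr_ge0 => r _; have [_ W0 _ _] := hW r; exact/W0/x0.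
Qed.

Section scaling.
Variable s : 'I_k -> R.
Hypothesis hs : forall r, 0 < s r.

Lemma preimage_block_scale_orthant :
  block_scale s @^-1` @product_orthant R k d = @product_orthant R k d.
Proof.
rewrite product_orthantE; apply/seteqP; split => x x0 i; have := x0 i;
  by rewrite mxE pmulr_rge0// invr_gt0.
Qed.

Lemma product_weight_block_scale (x : V) : product_orthant x ->
  product_weight W x =
  (\prod_(r < k) s r `^ theta r) * product_weight W (block_scale s x).
Proof.
move=> x0; rewrite /product_weight -big_split/=; apply: eq_bigr => r _.
have [_ _ _ <- //] := hW r.
  by rewrite submxrow_block_scale scalerA mulfV ?gt_eqF// scale1r.
suff : (block_scale s @^-1` @product_orthant R k d) x by exact.
by rewrite preimage_block_scale_orthant.
Qed.

Local Notation delta := (\prod_(r < k) s r `^ ((d r)%:R + theta r)).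

Lemma scaling_factor_gt0 : 0 < delta.
Proof. by apply: prodr_gt0 => r _; exact: powR_gt0. Qed.

Lemma measurable_block_scale : measurable_fun setT (block_scale s).
Proof. exact: measurable_coord_scale. Qed.

Lemma lebesgue_rV_block_scale (A : set V) : measurable A ->
  lebesgue_rV _ (block_scale s @^-1` A) =
  ((\prod_(r < k) s r ^+ d r)%:E * lebesgue_rV _ A)%E.
Proof.
move=> mA; rewrite lebesgue_rV_scale//; last by move=> i; rewrite invr_gt0.
by under eq_bigr do rewrite invrK; rewrite prod_sig1.
Qed.

(** Homogeneity makes the weight on X a constant times its composite with
    [block_scale s]; as X is stable under that map, the integral over the
    preimage becomes one to which the substitution for Lebesgue measure
    applies. *)
Lemma weighted_measure_block_scale (A : set V) : measurable A ->
  weighted_measure W (block_scale s @^-1` A) =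
  (delta%:E * weighted_measure W A)%E.
Proof.
move=> mA; rewrite /weighted_measure.
have mX := measurable_product_orthant.
have mAX : measurable (A `&` @product_orthant R k d) by exact: measurableI.
have mW : measurable_fun (A `&` @product_orthant R k d)
    (EFin \o product_weight W).
  by apply/measurable_EFinP; apply: measurable_funS measurable_product_weight.
have W0 x : (A `&` @product_orthant R k d) x ->
    (0 <= (product_weight W x)%:E)%E.
  by move=> [_ x0]; rewrite lee_fin; exact: product_weight_ge0.
rewrite -{1}preimage_block_scale_orthant -preimage_setI.
have mphi := measurable_block_scale.
pose c := \prod_(r < k) s r `^ theta r.
have c0 : 0 <= c by apply: prodr_ge0 => r _; exact: powR_ge0.
rewrite (eq_integral
  (fun x => c%:E * (product_weight W (block_scale s x))%:E)%E); last first.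
  move=> x /[!inE] -[_ x0]; rewrite -EFinM product_weight_block_scale//.
  by rewrite -preimage_block_scale_orthant.
rewrite ge0_integralZl_EFin//; last 3 first.
- by rewrite -[X in measurable X]setTI; exact: mphi.
- by move=> x; exact: W0.
- apply: (measurable_comp mAX) (mW) _ => //.
    by move=> _ [x x0 <-].
  exact: measurable_funTS.
have sd0 : 0 <= \prod_(r < k) s r ^+ d r.
  by apply: prodr_ge0 => r _; rewrite exprn_ge0// ltW.
rewrite (ge0_integral_comp_scaling mphi sd0 lebesgue_rV_block_scale mAX mW W0).
rewrite muleA -EFinM; congr ((_%:E) * _)%E.
rewrite /c -big_split/=; apply: eq_bigr => r _.
(* s_r > 0 makes the exponents additive, even when d_r + theta_r = 0 *)
rewrite powRD; first by rewrite powR_mulrn ?ltW// mulrC.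
by apply/implyP => _; rewrite gt_eqF.
Qed.

(** Integration theory against [weighted_measure W] needs it bundled as a
    measure: it is the indefinite integral of the weight extended by 0
    outside of X. *)
Lemma weighted_measure_is_measure :
  exists m : {measure set V -> \bar R},
    m = weighted_measure W :> (set V -> \bar R).
Proof.
have mX := measurable_product_orthant.
pose g := (EFin \o product_weight W) \_ (@product_orthant R k d).
have mg : measurable_fun setT g.
  apply/measurable_restrict => //; rewrite setTI.
  by apply/measurable_EFinP; exact: measurable_product_weight.
have g0 x : (0 <= g x)%E.
  rewrite /g patchE; case: ifPn => // /[!inE] x0.
  by rewrite lee_fin; exact: product_weight_ge0.
have gE : weighted_measure W = fun A => (\int[lebesgue_rV _]_(x in A) g x)%E.
  by apply/funext => A; rewrite /weighted_measure integral_mkcondr.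
have wm0 : weighted_measure W set0 = 0%E.
  by rewrite gE integral_set0.
have wm_ge0 A : (0 <= weighted_measure W A)%E.
  by rewrite gE; exact: integral_ge0.
have wm_add : semi_sigma_additive (weighted_measure W).
  by rewrite gE; exact: semi_sigma_additive_nng_induced.
pose mix := isMeasure.Build _ _ _ (weighted_measure W) wm0 wm_ge0 wm_add.
by exists (HB.pack_for {measure set V -> \bar R} (weighted_measure W) mix).
Qed.

Lemma measurable_dilation (h : V -> R) :
  measurable_fun (@product_orthant R k d) h ->
  measurable_fun (@product_orthant R k d) (dilation s h).
Proof.
move=> mh; rewrite dilationE.
apply: measurable_comp mh _; first exact: measurable_product_orthant.
  by move=> _ [x x0 <-]; rewrite -preimage_block_scale_orthant in x0.
by apply: measurable_funTS; exact: measurable_block_scale.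
Qed.

Lemma Lp_norm_dilation (p : R) (h : V -> R) :
  measurable_fun (@product_orthant R k d) h ->
  Lp_norm W p (dilation s h) = ((delta `^ p^-1)%:E * Lp_norm W p h)%E.
Proof.
move=> mh; rewrite /Lp_norm.
have [m mE] := weighted_measure_is_measure; rewrite -mE.
have mX := measurable_product_orthant.
have := @ge0_integral_comp_scaling _ _ _ m (block_scale s) delta
  (@product_orthant R k d) (fun x => (`|h x| `^ p)%:E).
rewrite preimage_block_scale_orthant dilationE/= => ->//.
- rewrite poweRM ?poweR_EFin//.
    by rewrite lee_fin ltW ?scaling_factor_gt0.
  by apply: integral_ge0 => x _; rewrite lee_fin powR_ge0.
- exact: measurable_block_scale.
- exact/ltW/scaling_factor_gt0.
- by move=> A mA; rewrite mE; exact: weighted_measure_block_scale.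
- apply/measurable_EFinP; apply: (measurableT_comp (measurable_powR p)).
  exact: measurableT_comp.
Qed.

End scaling.
End weight.
End dilations.

(** * The operator norm *)

Section grand_lebesgue.
Context {R : realType} (k : nat) (d : 'I_k -> nat) (theta : 'I_k -> R).
Variable W : forall r, 'rV[R]_(d r) -> R.
Hypothesis hW : forall r, homogeneous_weight (theta r) (@W r).
Variables (a : R) (b : \bar R) (s : 'I_k -> R).
Hypothesis hab : (a%:E < b)%E.
Hypothesis hs : forall r, 0 < s r.
Let V := 'rV[R]_(\sum_(r < k) d r).
Local Notation delta := (\prod_(r < k) s r `^ ((d r)%:R + theta r)).
Local Open Scope ereal_scope.

Lemma exponents_nonempty : exists p, exponents a b p.
Proof.
case: b hab => [b'| |]//; rewrite ?lte_fin => ab.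
  by exists ((a + b') / 2)%R; rewrite /exponents/= lte_fin !midf_lt.
by exists (a + 1)%R; split; [rewrite ltrDl|exact: ltry].
Qed.

Lemma Lp_norm_ge0 p (h : V -> R) : 0 <= Lp_norm W p h.
Proof. exact: poweR_ge0. Qed.

Lemma fundamental_function_ge0 (nu : R -> R) (t : R) :
  (forall p, exponents a b p -> (1 <= nu p)%R) ->
  0 <= fundamental_function a b nu t.
Proof.
move=> nu1; have [p pab] := exponents_nonempty.
apply: le_trans (ereal_sup_ubound _); last by exists p.
by rewrite lee_fin divr_ge0 ?powR_ge0// (le_trans ler01)// nu1.
Qed.

Section factor.
Variables psi zeta nu : R -> R.
Hypothesis psi1 : forall p, exponents a b p -> (1 <= psi p)%R.
Hypothesis nu1 : forall p, exponents a b p -> (1 <= nu p)%R.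
Hypothesis zetaE : forall p, exponents a b p -> zeta p = (psi p * nu p)%R.

(** Both bounds come from this identity: the ratio defining the norm of
    [dilation s h] splits into the quantity whose supremum is the fundamental
    function and the one whose supremum is the norm of [h]. *)
Lemma Lp_norm_dilation_ratio p (h : V -> R) : exponents a b p ->
  measurable_fun (@product_orthant R k d) h ->
  Lp_norm W p (dilation s h) * (zeta p)^-1%:E =
  (delta `^ p^-1 / nu p)%:E * (Lp_norm W p h * (psi p)^-1%:E).
Proof.
move=> pab mh; rewrite (Lp_norm_dilation hW hs)// zetaE// invfM !EFinM.
rewrite -!muleA; congr (_ * _).
by rewrite muleC -muleA muleC [in RHS]muleC -!muleA muleC -!muleA.
Qed.

Lemma G_norm_dilation_le (h : V -> R) :
  measurable_fun (@product_orthant R k d) h ->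
  G_norm W a b zeta (dilation s h) <=
  fundamental_function a b nu delta * G_norm W a b psi h.
Proof.
move=> mh; apply: ge_ereal_sup => _ [p pab <-].
rewrite Lp_norm_dilation_ratio//.
have nu0 : (0 <= nu p)%R by rewrite (le_trans ler01)// nu1.
have psi0 : (0 <= psi p)%R by rewrite (le_trans ler01)// psi1.
apply: lee_pmul.
- by rewrite lee_fin divr_ge0 ?powR_ge0.
- by rewrite mule_ge0 ?Lp_norm_ge0// lee_fin invr_ge0.
- by apply: ereal_sup_ubound; exists p.
- by apply: ereal_sup_ubound; exists p.
Qed.

(** When the fundamental function is infinite there is nothing to prove;
    otherwise its value is an admissible constant, and its finiteness is what
    puts the dilate of [h] into G(zeta). *)
Lemma G_operator_norm_dilation_le :
  G_operator_norm W a b (dilation s) psi zeta <=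
  fundamental_function a b nu delta.
Proof.
have := fundamental_function_ge0 delta nu1.
case phiE : (fundamental_function a b nu delta) => [C| |]//; last first.
  by move=> _; exact: leey.
rewrite lee_fin => C0.
apply: ereal_inf_lbound; exists C => //; split=> // h [mh hoo].
have hle := G_norm_dilation_le mh; rewrite phiE in hle.
split=> //; split; first exact: (measurable_dilation hs).
by apply: le_lt_trans hle _; exact: lte_mul_pinfty.
Qed.

(** The function f that represents psi is extremal: its ratios |f|_p / psi(p)
    are all equal to 1, so no loss occurs in bounding the product of the two
    factors of [Lp_norm_dilation_ratio]. *)
Lemma fundamental_function_le_G_operator_norm (f : V -> R) :
  (\bigcap_(p in exponents a b) Lp W p) f ->
  (forall p, exponents a b p -> (psi p)%:E = Lp_norm W p f) ->
  fundamental_function a b nu delta <=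
  G_operator_norm W a b (dilation s) psi zeta.
Proof.
move=> fLp psiE.
have mf : measurable_fun (@product_orthant R k d) f.
  by have [p /fLp[]] := exponents_nonempty.
have ratio1 p : exponents a b p -> Lp_norm W p f * (psi p)^-1%:E = 1.
  move=> pab; rewrite -psiE// -EFinM divff// gt_eqF//.
  by rewrite (lt_le_trans ltr01)// psi1.
have f1 : G_norm W a b psi f = 1.
  rewrite /G_norm (_ : [set _ | _ in _] = [set 1]) ?ereal_sup1//.
  apply/seteqP; split => [_ [p pab <-]|_ ->]; first exact: ratio1.
  by have [p pab] := exponents_nonempty; exists p => //; exact: ratio1.
have Tf : G_norm W a b zeta (dilation s f) = fundamental_function a b nu delta.
  rewrite /G_norm /fundamental_function; congr ereal_sup.
  by apply: eq_imagel => p pab; rewrite Lp_norm_dilation_ratio// ratio1// mule1.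
apply: le_ereal_inf_tmp => _ [C [C0 Cop] <-].
have [|_] := Cop f; first by split=> //; rewrite f1 ltry.
by rewrite Tf f1 mule1.
Qed.

End factor.
End grand_lebesgue.

Theorem theorem1p1 (R : realType) (k : nat) (d : 'I_k -> nat)
  (theta : 'I_k -> R) (W : forall r : 'I_k, 'rV[R]_(d r) -> R)
  (a : R) (b : \bar R) (s : 'I_k -> R)
  (hk : (0 < k)%N) (hd : forall r, (0 < d r)%N)
  (hW : forall r, homogeneous_weight (theta r) (W r))
  (ha : 1 <= a) (hab : (a%:E < b)%E) (hs : forall r, 0 < s r) :
  (forall psi zeta nu : R -> R,
     EPsi a b psi -> EPsi a b zeta -> EPsi a b nu ->
     (forall p, exponents a b p -> zeta p = psi p * nu p) ->
     (G_operator_norm W a b (dilation s) psi zeta <=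
      fundamental_function a b nu
        (\prod_(r < k) s r `^ ((d r)%:R + theta r)))%E) /\
  (forall psi zeta nu : R -> R,
     Psi W a b psi -> EPsi a b zeta -> EPsi a b nu ->
     (forall p, exponents a b p -> zeta p = psi p * nu p) ->
     G_operator_norm W a b (dilation s) psi zeta =
     fundamental_function a b nu
       (\prod_(r < k) s r `^ ((d r)%:R + theta r))).
Proof.
split.
  move=> psi zeta nu [psi1 _ _ _] _ [nu1 _ _ _] zetaE.
  exact: (G_operator_norm_dilation_le hW hab hs psi1 nu1 zetaE).
move=> psi zeta nu [[psi1 _ _ _] [f fLp psiE]] _ [nu1 _ _ _] zetaE.
apply/eqP; rewrite eq_le; apply/andP; split.
  exact: (G_operator_norm_dilation_le hW hab hs psi1 nu1 zetaE).
exact: (fundamental_function_le_G_operator_norm hW hab hs psi1 zetaE fLp psiE).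
Qed.
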